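(* Let $g \geq 2$ and $h \geq 4$ be integers, and let $x_h$ be the unique real number in $(0,\pi)$ satisfying \[ \frac{\sin x_h}{x_h} = \left( \frac{4}{3 - \cos(\pi/h)} - 1 \right)^h . \] Then for every $\varepsilon > 0$ there is $N_0 = N_0(h,g,\varepsilon)$ such that for all $N \geq N_0$, every $B_h[g]$-set $A \subseteq [N]$ satisfies \[ |A| \leq (1+\varepsilon) \left( \frac{x_h \, h! \, h \, g \, N}{\pi} \right)^{1/h}. \] (That is, $|A| \leq (1+o_N(1)) \left( \frac{x_h h! h g N}{\pi}\right)^{1/h}$.)
   Context: $[N] = \{1,2,\dots,N\}$. For positive integers $h,g$, a set $A \subseteq [N]$ is a $B_h[g]$-set if for every integer $n$ there are at most $g$ distinct multisets $\{a_1,\dots,a_h\}$ of size $h$ with all $a_i \in A$ and $a_1 + \dots + a_h = n$. *)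

(* Defs.v *)
From Stdlib Require Import Reals Lra Lia Arith List Sorted.
Import ListNotations.

Definition subset_interval (N : nat) (A : list nat) : Prop :=
  NoDup A /\ forall a, In a A -> 1 <= a <= N.

(* A multiset of size h with elements in A, represented canonically as a
   nondecreasing list of length h. *)
Definition multiset_in (h : nat) (A : list nat) (m : list nat) : Prop :=
  length m = h /\ Sorted le m /\ (forall a, In a m -> In a A).

Definition Bhg_set (h g : nat) (A : list nat) : Prop :=
  forall (n : nat) (L : list (list nat)),
    NoDup L ->
    (forall m, In m L -> multiset_in h A m /\ list_sum m = n) ->
    length L <= g.

(* Main.v *)
Require Import Defs.
From Stdlib Require Import Reals Lra Lia Arith List Sorted Permutation Mergesort.
From Coquelicot Require Import Coquelicot.
Import ListNotations.
Open Scope R_scope.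

(** Let [f(t) = sum_(a in A) e^(i a t)], [k = |A|], [K = g h!], [M = h N] and
    [x = PI k^h / (K M)].  The coefficients of [f^h = sum_n r(n) e^(i n t)] satisfy
    [0 <= r(n) <= K] and have total [k^h], so at [t = 2 PI j / M] the modulus of [f^h] is at
    most the value obtained by packing the mass onto arcs of half-width [x], namely
    [k^h sin x / x + O(1)].  Conversely, with [c = cos (PI / h)], the function
    [2 cos y - (1 - c) cos (h y)] is at least [1 + c] on [[-PI/h, PI/h]]; summing it over a
    centred and rescaled copy of [A] gives [(1 + c) k <= 2 |f(t_1)| + (1 - c) |f(t_h)|], so one
    of the two moduli is at least [(1 + c) / (3 - c) * k].  Hence
    [((1 + c) / (3 - c))^h <= sin x / x + o(1)], and [x <= (1 + o(1)) x_h] because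
    [sin x / x] is decreasing. *)

(** * Orderings of a multiset and representation counts *)

Fixpoint insertions (a : nat) (l : list nat) : list (list nat) :=
  match l with
  | [] => [[a]]
  | b :: l' => (a :: l) :: map (cons b) (insertions a l')
  end.

(** Equal entries are not merged, so the length is the full factorial even when some orderings
    coincide. *)
Fixpoint arrangements (l : list nat) : list (list nat) :=
  match l with
  | [] => [[]]
  | a :: l' => flat_map (insertions a) (arrangements l')
  end.

Lemma length_insertions a l : length (insertions a l) = S (length l).
Proof.
  induction l as [|b l IH]; simpl; [reflexivity|].
  now rewrite length_map, IH.
Qed.

Lemma in_insertions a l1 l2 : In (l1 ++ a :: l2) (insertions a (l1 ++ l2)).
Proof.
  induction l1 as [|b l1 IH]; simpl.
  - destruct l2; simpl; auto.
  - right. now apply in_map.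
Qed.

Lemma insertions_length_in a l m : In m (insertions a l) -> length m = S (length l).
Proof.
  revert m; induction l as [|b l IH]; simpl; intros m [<-|H]; try easy.
  apply in_map_iff in H as [m' [<- Hm']]. simpl. now rewrite (IH m').
Qed.

Lemma arrangements_length_in l m : In m (arrangements l) -> length m = length l.
Proof.
  revert m; induction l as [|a l IH]; simpl; intros m H.
  - destruct H as [<-|[]]; reflexivity.
  - apply in_flat_map in H as [p [Hp Hm]].
    rewrite (insertions_length_in _ _ _ Hm), (IH p Hp). reflexivity.
Qed.

Lemma length_arrangements l : length (arrangements l) = fact (length l).
Proof.
  induction l as [|a l IH]; [reflexivity|].
  change (length (flat_map (insertions a) (arrangements l)) = fact (S (length l))).
  rewrite (flat_map_constant_length (c := S (length l))).
  - rewrite IH. simpl. lia.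
  - intros m Hm. rewrite length_insertions.
    now rewrite (arrangements_length_in _ _ Hm).
Qed.

Lemma in_arrangements l m : Permutation m l -> In m (arrangements l).
Proof.
  revert m; induction l as [|a l IH]; intros m H; simpl.
  - apply Permutation_sym, Permutation_nil in H. subst. now left.
  - destruct (Permutation_vs_cons_inv H) as [l1 [l2 ->]].
    apply in_flat_map. exists (l1 ++ l2). split.
    + apply IH. apply Permutation_sym, (Permutation_cons_app_inv l1 l2 (a := a)).
      now apply Permutation_sym.
    + apply in_insertions.
Qed.

(** The tuples index the terms in the expansion of [f^h], so [r(n)] counts those with sum [n]. *)
Fixpoint tuples (h : nat) (A : list nat) : list (list nat) :=
  match h with
  | O => [[]]
  | S k => flat_map (fun a => map (cons a) (tuples k A)) A
  end.

Lemma in_tuples h A m :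
  In m (tuples h A) -> length m = h /\ forall a, In a m -> In a A.
Proof.
  revert m; induction h as [|h IH]; simpl; intros m H.
  - destruct H as [<-|[]]. easy.
  - apply in_flat_map in H as [a [Ha H]].
    apply in_map_iff in H as [p [<- Hp]]. destruct (IH p Hp) as [H1 H2].
    split; [simpl; now rewrite H1|]. intros b [<-|Hb]; auto.
Qed.

Lemma length_tuples h A : length (tuples h A) = (length A ^ h)%nat.
Proof.
  induction h as [|h IH]; [reflexivity|].
  simpl tuples. rewrite (flat_map_constant_length (c := length A ^ h)).
  - simpl. reflexivity.
  - intros a _. now rewrite length_map.
Qed.

Lemma NoDup_tuples h A : NoDup A -> NoDup (tuples h A).
Proof.
  intros HA. induction h as [|h IH]; simpl.
  - repeat constructor. easy.
  - generalize (tuples h A) IH. intros T HT.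
    clear IH. induction HA as [|a A Ha HA IH]; simpl; [constructor|].
    apply NoDup_app.
    + apply FinFun.Injective_map_NoDup; [|assumption]. now intros x y [= ->].
    + assumption.
    + intros m Hm Hm'. apply in_map_iff in Hm as [p [<- _]].
      apply in_flat_map in Hm' as [b [Hb Hm']].
      apply in_map_iff in Hm' as [p' [[= <- _] _]]. contradiction.
Qed.

Lemma list_sum_permutation l m : Permutation l m -> list_sum l = list_sum m.
Proof. induction 1; simpl; lia. Qed.

Lemma NatSort_sort_Sorted_le l : Sorted le (NatSort.sort l).
Proof.
  generalize (NatSort.Sorted_sort l). generalize (NatSort.sort l).
  intros m H. induction H as [|a m Hm IH Hd]; constructor; [assumption|].
  destruct Hd as [|b m Hb]; constructor. now apply Nat.leb_le.
Qed.

(** Sorting sends an ordered tuple to the canonical form of its multiset. At most [g] multisets have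
    sum [n], and each comes from at most [h!] tuples; this gives [r(n) <= K]. *)
Lemma Bhg_representations h g A : NoDup A -> Bhg_set h g A -> forall n,
  (length (filter (fun m => list_sum m =? n)%nat (tuples h A)) <= g * fact h)%nat.
Proof.
  intros HA HB n.
  set (T := filter _ _).
  set (L := nodup (list_eq_dec Nat.eq_dec) (map NatSort.sort T)).
  assert (HL : forall m, In m L -> multiset_in h A m /\ list_sum m = n).
  { intros m Hm. apply nodup_In, in_map_iff in Hm as [p [<- Hp]].
    apply filter_In in Hp as [Hp Hs]. apply Nat.eqb_eq in Hs.
    destruct (in_tuples _ _ _ Hp) as [Hl Hi].
    pose proof (NatSort.Permuted_sort p) as HP.
    repeat split.
    - now rewrite <- (Permutation_length HP).
    - apply NatSort_sort_Sorted_le.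
    - intros a Ha. apply Hi. now apply (Permutation_in a (Permutation_sym HP)).
    - now rewrite <- (list_sum_permutation _ _ HP). }
  assert (HLg : (length L <= g)%nat) by (apply (HB n); [apply NoDup_nodup | exact HL]).
  (* The concatenated arrangements may repeat, but [T] has no duplicates, so it is enough that they
     cover [T]. *)
  apply Nat.le_trans with (length (flat_map arrangements L)).
  - apply NoDup_incl_length.
    + now apply NoDup_filter, NoDup_tuples.
    + intros m Hm. apply in_flat_map. exists (NatSort.sort m). split.
      * apply nodup_In. now apply in_map.
      * apply in_arrangements, NatSort.Permuted_sort.
  - rewrite (flat_map_constant_length (c := fact h)).
    + now apply Nat.mul_le_mono_r.
    + intros m Hm. rewrite length_arrangements.
      destruct (HL m Hm) as [[-> _] _]. reflexivity.
Qed.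

Lemma list_sum_bounds m M : (forall a, In a m -> 1 <= a <= M)%nat ->
  (length m <= list_sum m <= length m * M)%nat.
Proof.
  induction m as [|a m IH]; simpl; intros H; [lia|].
  pose proof (H a (or_introl eq_refl)).
  assert (length m <= list_sum m <= length m * M)%nat by auto. lia.
Qed.

(** * Finite sums of reals over lists *)

Definition Rsum {T : Type} (f : T -> R) (l : list T) : R :=
  fold_right Rplus 0 (map f l).

Lemma Rsum_app {T : Type} (f : T -> R) l m : Rsum f (l ++ m) = Rsum f l + Rsum f m.
Proof.
  unfold Rsum. induction l as [|x l IH]; simpl; [lra|]. rewrite IH. lra.
Qed.

Lemma Rsum_ext {T : Type} (f g : T -> R) l :
  (forall x, In x l -> f x = g x) -> Rsum f l = Rsum g l.
Proof.
  unfold Rsum. induction l as [|x l IH]; simpl; intros H; [reflexivity|].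
  rewrite H, IH; auto.
Qed.

Lemma Rsum_le {T : Type} (f g : T -> R) l :
  (forall x, In x l -> f x <= g x) -> Rsum f l <= Rsum g l.
Proof.
  unfold Rsum. induction l as [|x l IH]; simpl; intros H; [lra|].
  apply Rplus_le_compat; auto.
Qed.

Lemma Rsum_lin {T : Type} (f g : T -> R) a b l :
  Rsum (fun x => a * f x + b * g x) l = a * Rsum f l + b * Rsum g l.
Proof.
  unfold Rsum. induction l as [|x l IH]; simpl; [lra|]. rewrite IH. lra.
Qed.

Lemma Rsum_const {T : Type} c (l : list T) : Rsum (fun _ => c) l = INR (length l) * c.
Proof.
  unfold Rsum. induction l as [|x l IH]; [simpl; lra|].
  cbn [length]. rewrite S_INR. cbn [map fold_right]. rewrite IH. lra.
Qed.

Lemma Rsum_map {T U : Type} (f : U -> R) (p : T -> U) l :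
  Rsum f (map p l) = Rsum (fun x => f (p x)) l.
Proof. unfold Rsum. now rewrite map_map. Qed.

Lemma Rsum_flat_map {T U : Type} (f : U -> R) (p : T -> list U) l :
  Rsum f (flat_map p l) = Rsum (fun x => Rsum f (p x)) l.
Proof.
  induction l as [|x l IH]; [reflexivity|].
  simpl flat_map. rewrite Rsum_app, IH. reflexivity.
Qed.

Lemma Rsum_filter {T : Type} (f : T -> R) p l :
  Rsum f l = Rsum f (filter p l) + Rsum f (filter (fun x => negb (p x)) l).
Proof.
  unfold Rsum. induction l as [|x l IH]; simpl; [lra|].
  destruct (p x); simpl; lra.
Qed.

(** Grouping by the value of [s] uses each [F n] at most [K] times, and [F n >= 0] allows the
    multiplicity to be raised to [K]. The induction on [M] splits off the fibre over the largest
    value. With [s] the sum of a tuple, this is where [r(n) <= K] enters. *)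
Lemma Rsum_fibres {T : Type} (s : T -> nat) (F : nat -> R) (K M : nat) :
  (forall n, 0 <= F n) -> forall l,
  (forall x, In x l -> 1 <= s x <= M)%nat ->
  (forall n, length (filter (fun x => s x =? n)%nat l) <= K)%nat ->
  Rsum (fun x => F (s x)) l <= INR K * Rsum F (seq 1 M).
Proof.
  intros HF. induction M as [|M IH]; intros l Hl HK.
  - destruct l as [|x l].
    + unfold Rsum; simpl; lra.
    + specialize (Hl x (or_introl eq_refl)). lia.
  - rewrite (Rsum_filter _ (fun x => s x =? S M)%nat).
    rewrite seq_S, Rsum_app, Rmult_plus_distr_l, Rplus_comm.
    apply Rplus_le_compat.
    + apply IH.
      * intros x Hx. apply filter_In in Hx as [Hx Hn].
        apply Bool.negb_true_iff, Nat.eqb_neq in Hn. specialize (Hl x Hx). lia.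
      * intros n. eapply Nat.le_trans; [|apply (HK n)].
        clear. induction l as [|x l IH]; simpl; [lia|].
        destruct (s x =? S M)%nat, (s x =? n)%nat eqn:E; simpl; try rewrite E; simpl; lia.
    + rewrite (Rsum_ext _ (fun _ => F (S M))).
      * rewrite Rsum_const. unfold Rsum. simpl. rewrite Rplus_0_r.
        apply Rmult_le_compat_r; [apply HF|]. apply le_INR, HK.
      * intros x Hx. apply filter_In in Hx as [_ Hn]. apply Nat.eqb_eq in Hn.
        now rewrite Hn.
Qed.

(** * Exponential sums in real form *)

Lemma polar_coordinates (P Q : R) :
  exists rho psi, 0 <= rho /\ P = rho * cos psi /\ Q = rho * sin psi.
Proof.
  set (rho := sqrt (P * P + Q * Q)).
  assert (Hsq : rho * rho = P * P + Q * Q) by (apply sqrt_sqrt; nra).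
  assert (H0 : 0 <= rho) by apply sqrt_pos.
  destruct (Req_dec rho 0) as [Hz|Hz].
  - exists 0, 0. rewrite Hz in Hsq. repeat split; nra.
  - assert (Hu : (P / rho) * rho = P) by (field; lra).
    assert (Hb : -1 <= P / rho <= 1).
    { set (u := P / rho) in *. assert (u * u <= 1) by
        (apply Rmult_le_reg_r with (rho * rho); rewrite <- Hu in Hsq; nra).
      split; nra. }
    assert (Hs : rho * sin (acos (P / rho)) = Rabs Q).
    { rewrite sin_acos by exact Hb. unfold Rsqr.
      rewrite <- (sqrt_square (Rabs Q)) by apply Rabs_pos.
      rewrite <- (sqrt_square rho) at 1 by exact H0.
      rewrite <- sqrt_mult_alt by nra. f_equal.
      rewrite <- Rabs_mult, Rabs_pos_eq by nra.
      set (u := P / rho) in *. rewrite <- Hu in Hsq. nra. }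
    (* [acos] only returns angles of the upper half plane, so the sign of [Q] decides the sign of
       the angle. *)
    exists rho. destruct (Rle_dec 0 Q) as [HQ|HQ].
    + exists (acos (P / rho)). rewrite cos_acos, Hs, Rabs_pos_eq by assumption. lra.
    + exists (- acos (P / rho)). rewrite cos_neg, sin_neg, cos_acos by assumption.
      rewrite Rabs_left in Hs by lra. lra.
Qed.

(* [rho] and [psi] are the modulus and argument of the exponential sum of [A] at [t]. *)
Lemma exponential_sum (A : list nat) (t : R) :
  exists rho psi, 0 <= rho /\
  forall alpha, Rsum (fun a => cos (INR a * t + alpha)) A = rho * cos (psi + alpha).
Proof.
  destruct (polar_coordinates (Rsum (fun a => cos (INR a * t)) A)
              (Rsum (fun a => sin (INR a * t)) A)) as [rho [psi [H0 [HP HQ]]]].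
  exists rho, psi. split; [exact H0|]. intros alpha.
  rewrite (Rsum_ext _ (fun a => cos alpha * cos (INR a * t) + (- sin alpha) * sin (INR a * t))).
  - rewrite Rsum_lin, HP, HQ, cos_plus. ring.
  - intros a _. rewrite cos_plus. ring.
Qed.

(** Both sides are the real part of [e^(i alpha) f(t)^h]. Keeping [alpha] arbitrary lets the
    induction absorb the phase [a t] of the first entry. *)
Lemma exponential_sum_tuples (A : list nat) (t rho psi : R) (h : nat) :
  (forall alpha, Rsum (fun a => cos (INR a * t + alpha)) A = rho * cos (psi + alpha)) ->
  forall alpha, Rsum (fun m => cos (INR (list_sum m) * t + alpha)) (tuples h A)
    = rho ^ h * cos (INR h * psi + alpha).
Proof.
  intros HA. induction h as [|h IH]; intros alpha.
  - unfold Rsum; simpl. rewrite !Rmult_0_l. ring.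
  - simpl tuples. rewrite Rsum_flat_map.
    (* The zero term gives the summand the shape of a linear combination, as [Rsum_lin] expects. *)
    rewrite (Rsum_ext _ (fun a => rho ^ h * cos (INR a * t + (INR h * psi + alpha))
                                  + 0 * cos (INR a * t))).
    + rewrite Rsum_lin, HA, S_INR. simpl.
      replace ((INR h + 1) * psi + alpha) with (psi + (INR h * psi + alpha)) by ring. ring.
    + intros a _. rewrite Rsum_map.
      rewrite (Rsum_ext _ (fun m => cos (INR (list_sum m) * t + (INR a * t + alpha)))).
      * rewrite IH. rewrite Rmult_0_l, Rplus_0_r. do 2 f_equal. ring.
      * intros m _. simpl. rewrite plus_INR. f_equal. ring.
Qed.

(** * The truncated cosine and its Riemann sums *)

Lemma cos_lipschitz a b : Rabs (cos a - cos b) <= Rabs (a - b).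
Proof.
  destruct (MVT_gen cos b a (fun x => - sin x)) as [c [_ ->]].
  - intros x _. auto_derive; [exact I | ring].
  - intros x _. apply continuity_cos.
  - rewrite Rabs_mult. rewrite <- (Rmult_1_l (Rabs (a - b))) at 2.
    apply Rmult_le_compat_r; [apply Rabs_pos|].
    rewrite Rabs_Ropp. apply Rabs_le, SIN_bound.
Qed.

(** The slack in the duality argument: [cos y <= cos x + cos_excess x y], and for [0 <= x <= PI] the
    excess lives, modulo [2 PI], on the arc of half-width [x]. *)
Definition cos_excess (x y : R) : R := Rmax (cos y - cos x) 0.

Lemma cos_excess_pos x y : 0 <= cos_excess x y.
Proof. apply Rmax_r. Qed.

Lemma cos_excess_lipschitz x a b :
  Rabs (cos_excess x a - cos_excess x b) <= Rabs (a - b).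
Proof.
  eapply Rle_trans; [|apply cos_lipschitz]. unfold cos_excess, Rmax.
  destruct (Rle_dec (cos a - cos x) 0), (Rle_dec (cos b - cos x) 0);
    unfold Rabs; repeat destruct (Rcase_abs _); lra.
Qed.

Lemma cos_excess_continuous x y : continuous (cos_excess x) y.
Proof.
  apply continuity_pt_filterlim. intros eps He. exists eps. split; [exact He|].
  intros z [_ Hz]. eapply Rle_lt_trans; [apply cos_excess_lipschitz | exact Hz].
Qed.

Lemma cos_excess_ex_RInt x a b : ex_RInt (cos_excess x) a b.
Proof.
  apply (ex_RInt_continuous (V := R_CompleteNormedModule)).
  intros z _. apply cos_excess_continuous.
Qed.

Lemma cos_ge_on_symmetric_interval x y : 0 <= x <= PI -> - x <= y <= x -> cos x <= cos y.
Proof.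
  intros Hx Hy. destruct (Rle_dec 0 y).
  - apply cos_decr_1; lra.
  - rewrite <- (cos_neg y). apply cos_decr_1; lra.
Qed.

(** Within this period the excess vanishes outside [[-x, x]], and inside it has the primitive
    [sin y - y * cos x]. *)
Lemma RInt_cos_excess_period x : 0 <= x <= PI ->
  RInt (cos_excess x) (- PI) PI = 2 * (sin x - x * cos x).
Proof.
  intros Hx. apply is_RInt_unique.
  assert (Hz : forall a b, - PI <= a <= b -> b <= PI -> b <= - x \/ x <= a ->
            is_RInt (cos_excess x) a b 0).
  { intros a b Hab Hb Ho.
    apply (is_RInt_ext (fun _ => 0)).
    - rewrite Rmin_left, Rmax_right by lra. intros y Hy.
      unfold cos_excess. rewrite Rmax_right; [reflexivity|].
      assert (cos y <= cos x); [|lra].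
      destruct Ho; [rewrite <- (cos_neg y)|]; apply cos_decr_1; lra.
    - pose proof (is_RInt_const (V := R_NormedModule) a b 0) as H.
      change (is_RInt (fun _ => 0) a b ((b - a) * 0)) in H.
      rewrite Rmult_0_r in H. exact H. }
  assert (Hm : is_RInt (cos_excess x) (- x) x (2 * (sin x - x * cos x))).
  { apply (is_RInt_ext (fun y => cos y - cos x)).
    - rewrite Rmin_left, Rmax_right by lra. intros y Hy.
      unfold cos_excess. rewrite Rmax_left; [reflexivity|].
      assert (cos x <= cos y) by (apply cos_ge_on_symmetric_interval; lra). lra.
    - replace (2 * (sin x - x * cos x))
        with (minus (sin x - x * cos x) (sin (- x) - (- x) * cos x))
        by (rewrite sin_neg; unfold minus, plus, opp; simpl; ring).
      apply (is_RInt_derive (V := R_CompleteNormedModule) (fun y => sin y - y * cos x)).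
      + intros y _. auto_derive; [exact I | ring].
      + intros y _. apply (continuous_minus (V := R_NormedModule)).
        * apply continuity_pt_filterlim, continuity_cos.
        * apply continuous_const. }
  replace (2 * (sin x - x * cos x)) with (plus (plus 0 (2 * (sin x - x * cos x))) 0)
    by (unfold plus; simpl; ring).
  apply (is_RInt_Chasles (V := R_NormedModule) _ _ x).
  - apply (is_RInt_Chasles (V := R_NormedModule) _ _ (- x)); [apply Hz; lra | exact Hm].
  - apply Hz; lra.
Qed.

Definition cos_excess_primitive (x y : R) : R := RInt (cos_excess x) 0 y.

Lemma cos_excess_primitive_derive x y :
  is_derive (cos_excess_primitive x) y (cos_excess x y).
Proof.
  apply (is_derive_RInt (V := R_NormedModule) (cos_excess x) _ 0).
  - exists (mkposreal 1 Rlt_0_1). intros z _.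
    apply (RInt_correct (V := R_CompleteNormedModule)), cos_excess_ex_RInt.
  - apply cos_excess_continuous.
Qed.

(** The increment over one period has zero derivative, hence does not depend on [y]; at [- PI] it is
    the integral already computed. *)
Lemma cos_excess_primitive_period x y : 0 <= x <= PI ->
  cos_excess_primitive x (y + 2 * PI) - cos_excess_primitive x y
  = 2 * (sin x - x * cos x).
Proof.
  intros Hx. set (D := fun y => cos_excess_primitive x (y + 2 * PI) - cos_excess_primitive x y).
  assert (HD : forall z, is_derive D z 0).
  { intros z. replace 0 with (1 * cos_excess x (z + 2 * PI) - cos_excess x z).
    - apply (is_derive_minus (V := R_NormedModule)); [|apply cos_excess_primitive_derive].
      apply (is_derive_comp (cos_excess_primitive x) (fun y => y + 2 * PI)).
      + apply cos_excess_primitive_derive.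
      + auto_derive; [exact I | ring].
    - unfold cos_excess. rewrite cos_plus, cos_2PI, sin_2PI.
      rewrite Rmult_1_r, Rmult_0_r, Rminus_0_r. ring. }
  change (D y = 2 * (sin x - x * cos x)).
  rewrite <- RInt_cos_excess_period by assumption.
  transitivity (D (- PI)).
  - destruct (MVT_gen D (- PI) y (fun _ => 0)) as [c [_ Hc]].
    + intros z _. apply HD.
    + intros z _. apply continuity_pt_filterlim, (ex_derive_continuous D). exists 0. apply HD.
    + lra.
  - unfold D, cos_excess_primitive. replace (- PI + 2 * PI) with PI by ring.
    rewrite <- (RInt_Chasles (V := R_CompleteNormedModule) (cos_excess x) 0 (- PI) PI)
      by apply cos_excess_ex_RInt.
    unfold plus; simpl. ring.
Qed.

Lemma cos_excess_primitive_periods x y j : 0 <= x <= PI ->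
  cos_excess_primitive x (y + INR j * (2 * PI)) - cos_excess_primitive x y
  = INR j * (2 * (sin x - x * cos x)).
Proof.
  intros Hx. induction j as [|j IH].
  - simpl. rewrite Rmult_0_l, Rplus_0_r. ring.
  - pose proof (cos_excess_primitive_period x (y + INR j * (2 * PI)) Hx) as H.
    rewrite S_INR.
    replace (y + (INR j + 1) * (2 * PI)) with (y + INR j * (2 * PI) + 2 * PI) by ring.
    lra.
Qed.

(** On each step the increment of the primitive is [t] times an intermediate value of the excess. By
    the Lipschitz bound that value is within [t] of the one at the right endpoint, which costs [t^2]
    per step. *)
Lemma cos_excess_riemann_sum x t alpha M : 0 <= t ->
  t * Rsum (fun n => cos_excess x (INR n * t + alpha)) (seq 1 M)
  <= cos_excess_primitive x (INR M * t + alpha) - cos_excess_primitive x alpha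
     + INR M * t ^ 2.
Proof.
  intros Ht. induction M as [|M IH].
  - unfold Rsum; simpl. rewrite Rmult_0_l, Rplus_0_l. lra.
  - rewrite seq_S, Rsum_app, Rmult_plus_distr_l. unfold Rsum at 2; cbn [map fold_right].
    rewrite Rplus_0_r. change (INR (1 + M)) with (INR (S M)).
    destruct (MVT_gen (cos_excess_primitive x) (INR M * t + alpha) (INR (S M) * t + alpha)
                (cos_excess x)) as [c [Hc HG]].
    + intros z _. apply cos_excess_primitive_derive.
    + intros z _. apply continuity_pt_filterlim, (ex_derive_continuous (cos_excess_primitive x)).
      eexists. apply cos_excess_primitive_derive.
    + pose proof (cos_excess_lipschitz x (INR (S M) * t + alpha) c) as HL.
      apply Rabs_le_between in HL.
      rewrite S_INR in *. rewrite Rmin_left, Rmax_right in Hc by nra.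
      rewrite (Rabs_pos_eq (_ - c)) in HL by lra.
      replace ((INR M + 1) * t + alpha - (INR M * t + alpha)) with t in HG by ring.
      set (y := (INR M + 1) * t + alpha) in *.
      assert (t * (cos_excess x y - cos_excess x c) <= t * t)
        by (apply Rmult_le_compat_l; unfold y in *; lra).
      lra.
Qed.

(** The grid spans exactly [j] periods, so the main term is free of [alpha]. Dividing the error
    [M t^2] by [t] leaves [M t = 2 PI j]. *)
Lemma cos_excess_sum x alpha M j : 0 <= x <= PI -> (0 < M)%nat -> (0 < j)%nat ->
  Rsum (fun n => cos_excess x (INR n * (2 * PI * INR j / INR M) + alpha)) (seq 1 M)
  <= INR M / PI * (sin x - x * cos x) + 2 * PI * INR j.
Proof.
  intros Hx HM Hj'. pose proof PI_RGT_0 as Hpi.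
  assert (HM' : 0 < INR M) by now apply lt_0_INR.
  assert (Hj : 0 < INR j) by now apply lt_0_INR.
  set (t := 2 * PI * INR j / INR M).
  assert (Ht : 0 < t) by (unfold t; apply Rdiv_lt_0_compat; nra).
  assert (Htm : INR M * t = INR j * (2 * PI)) by (unfold t; field; lra).
  pose proof (cos_excess_riemann_sum x t alpha M (Rlt_le _ _ Ht)) as H.
  rewrite Htm in H. replace (INR j * (2 * PI) + alpha) with (alpha + INR j * (2 * PI)) in H by ring.
  rewrite cos_excess_primitive_periods in H by exact Hx.
  apply Rmult_le_reg_l with t; [exact Ht|]. eapply Rle_trans; [exact H|].
  apply Req_le. unfold t. field. lra.
Qed.

(** * Inequalities for sines and for the kernel *)

Lemma sin_slope_decr a b : 0 < a -> a < b -> b <= PI -> a * sin b < b * sin a.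
Proof.
  intros Ha Hab Hb.
  (* The mean slope of [sin] over [[0, a]] exceeds that over [[a, b]], because [cos] decreases on
     [[0, PI]]. *)
  destruct (MVT_cor2 sin cos 0 a Ha) as [c [Hc Hc']]; [intros; apply derivable_pt_lim_sin|].
  destruct (MVT_cor2 sin cos a b Hab) as [d [Hd Hd']]; [intros; apply derivable_pt_lim_sin|].
  rewrite sin_0 in Hc.
  assert (cos d < cos c) by (apply cos_decreasing_1; lra).
  assert (a * (sin b - sin a) < (b - a) * sin a).
  { rewrite Hd. replace (sin a) with (cos c * a) by lra.
    replace (a * (cos d * (b - a))) with (a * (b - a) * cos d) by ring.
    replace ((b - a) * (cos c * a)) with (a * (b - a) * cos c) by ring.
    apply Rmult_lt_compat_l; nra. }
  lra.
Qed.

(* [sin (n s) / sin s] decreases: [sin ((n+1) s) / sin s = cos s * sin (n s) / sin s + cos (n s)]. *)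
Lemma sin_multiple_ratio (n : nat) s t : 0 <= s -> s <= t -> INR n * t <= PI / 2 -> t <= PI / 2 ->
  sin (INR n * t) * sin s <= sin (INR n * s) * sin t.
Proof.
  intros Hs Hst. pose proof PI_RGT_0 as Hpi.
  induction n as [|n IH]; intros Hn Ht.
  - simpl. rewrite !Rmult_0_l, sin_0. lra.
  - rewrite S_INR in *. pose proof (pos_INR n) as Hn0.
    rewrite !Rmult_plus_distr_r, !Rmult_1_l, !sin_plus.
    assert (H1 : 0 <= sin s) by (apply sin_ge_0; lra).
    assert (H2 : 0 <= sin t) by (apply sin_ge_0; lra).
    assert (H3 : cos t <= cos s) by (apply cos_decr_1; lra).
    assert (H4 : cos (INR n * t) <= cos (INR n * s)) by (apply cos_decr_1; nra).
    assert (H5 : 0 <= cos t) by (apply cos_ge_0; lra).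
    assert (H6 : 0 <= sin (INR n * s)) by (apply sin_ge_0; nra).
    assert (H7 : sin (INR n * t) * sin s <= sin (INR n * s) * sin t) by (apply IH; nra).
    assert (sin (INR n * t) * sin s * cos t <= sin (INR n * s) * sin t * cos s).
    { apply Rle_trans with (sin (INR n * s) * sin t * cos t).
      - now apply Rmult_le_compat_r.
      - apply Rmult_le_compat_l; [nra | exact H3]. }
    assert (cos (INR n * t) * (sin s * sin t) <= cos (INR n * s) * (sin s * sin t)).
    { apply Rmult_le_compat_r; nra. }
    lra.
Qed.

(* After halving angles this says [sin s <= sin (h s) sin t] with [t = PI / (2 h)], which
   is [sin_multiple_ratio] because [sin (h t) = 1]. *)
Lemma kernel_lower_bound (h : nat) x : (1 <= h)%nat -> Rabs x <= PI / INR h ->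
  1 + cos (PI / INR h) <= 2 * cos x - (1 - cos (PI / INR h)) * cos (INR h * x).
Proof.
  intros Hh Hx. pose proof PI_RGT_0 as Hpi.
  assert (H1 : 1 <= INR h) by (change 1 with (INR 1); now apply le_INR).
  assert (Hc : forall y, cos (Rabs y) = cos y).
  { intros y. unfold Rabs. destruct (Rcase_abs y); [apply cos_neg | reflexivity]. }
  rewrite <- (Hc x), <- (Hc (INR h * x)), Rabs_mult, (Rabs_pos_eq (INR h)) by lra.
  pose proof (Rabs_pos x) as Hx0. set (y := Rabs x) in *.
  set (s := y / 2). set (t := PI / INR h / 2).
  replace y with (2 * s) by (unfold s; field).
  replace (INR h * (2 * s)) with (2 * (INR h * s)) by ring.
  replace (PI / INR h) with (2 * t) by (unfold t; field; lra).
  rewrite !cos_2a_sin.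
  assert (Hnt : INR h * t = PI / 2) by (unfold t; field; lra).
  assert (Hst : s <= t) by (unfold s, t; lra).
  assert (Hs : 0 <= s) by (unfold s; lra).
  assert (Ht : t <= PI / 2) by nra.
  pose proof (sin_multiple_ratio h s t Hs Hst (Req_le _ _ Hnt) Ht) as H.
  rewrite Hnt, sin_PI2, Rmult_1_l in H.
  assert (0 <= sin s) by (apply sin_ge_0; lra).
  assert (sin s * sin s <= (sin (INR h * s) * sin t) * (sin (INR h * s) * sin t))
    by (apply Rmult_le_compat; assumption).
  nra.
Qed.

(** * The inequality for a fixed [N] *)

Section Bound.

Variables (h N K : nat) (A : list nat).
Hypothesis Hh : (1 <= h)%nat.
Hypothesis HN : (1 <= N)%nat.
Hypothesis HA : forall a, In a A -> (1 <= a <= N)%nat.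
Hypothesis HK : forall n,
  (length (filter (fun m => list_sum m =? n)%nat (tuples h A)) <= K)%nat.

Lemma tuples_sum_bounds m : In m (tuples h A) -> (1 <= list_sum m <= h * N)%nat.
Proof.
  intros Hm. destruct (in_tuples _ _ _ Hm) as [Hl Hi].
  pose proof (list_sum_bounds m N (fun a Ha => HA a (Hi a Ha))) as H.
  rewrite Hl in H. lia.
Qed.

(** Counting all tuples by their sum; this is what keeps the half-width [x] at most [PI]. *)
Lemma card_pow_le : INR (length A) ^ h <= INR K * INR (h * N).
Proof.
  pose proof (Rsum_fibres list_sum (fun _ => 1) K (h * N) (fun _ => Rle_0_1)
                (tuples h A) tuples_sum_bounds HK) as H.
  rewrite !Rsum_const, length_seq, length_tuples, pow_INR in H. lra.
Qed.

(* The best weights in [0, K] with given total concentrate where the cosine exceeds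
   [cos x]; bounding [cos] by [cos x + cos_excess x] encodes this rearrangement by
   linear duality. *)
Lemma exponential_sum_bound (j : nat) (x rho psi : R) :
  (1 <= j)%nat -> 0 <= x <= PI ->
  INR (length A) ^ h = INR K * INR (h * N) / PI * x ->
  (forall alpha, Rsum (fun a => cos (INR a * (2 * PI * INR j / INR (h * N)) + alpha)) A
                 = rho * cos (psi + alpha)) ->
  rho ^ h <= INR K * INR (h * N) / PI * sin x + INR K * (2 * PI * INR j).
Proof.
  intros Hj Hx HS Hrho. pose proof PI_RGT_0 as Hpi.
  set (t := 2 * PI * INR j / INR (h * N)) in *.
  (* This shift cancels the argument of [f(t)^h], so that the cosine sum equals the modulus
     [rho^h]. *)
  set (alpha := - (INR h * psi)).
  pose proof (exponential_sum_tuples A t rho psi h Hrho alpha) as HT.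
  replace (INR h * psi + alpha) with 0 in HT by (unfold alpha; ring).
  rewrite cos_0, Rmult_1_r in HT. rewrite <- HT.
  apply Rle_trans with (cos x * INR (length A) ^ h
    + INR K * Rsum (fun n => cos_excess x (INR n * t + alpha)) (seq 1 (h * N))).
  - apply Rle_trans with
      (Rsum (fun m => cos x * 1 + 1 * cos_excess x (INR (list_sum m) * t + alpha)) (tuples h A)).
    + apply Rsum_le. intros m _. unfold cos_excess.
      pose proof (Rmax_l (cos (INR (list_sum m) * t + alpha) - cos x) 0). lra.
    + rewrite Rsum_lin, Rsum_const, length_tuples, pow_INR, Rmult_1_r, Rmult_1_l.
      apply Rplus_le_compat_l.
      apply (Rsum_fibres list_sum (fun n => cos_excess x (INR n * t + alpha)) K (h * N)).
      * intros n. apply cos_excess_pos.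
      * apply tuples_sum_bounds.
      * exact HK.
  (* After this substitution [cos x * k^h] cancels the [x * cos x] part of the excess sum, and only
     [sin x] remains. *)
  - rewrite HS.
    assert (H := cos_excess_sum x alpha (h * N) j Hx ltac:(nia) Hj). fold t in H.
    apply (Rmult_le_compat_l (INR K)) in H; [|apply pos_INR].
    eapply Rle_trans; [apply Rplus_le_compat_l, H|].
    apply Req_le. field. lra.
Qed.

Lemma card_pow_bound (x : R) :
  0 <= x <= PI ->
  INR (length A) ^ h = INR K * INR (h * N) / PI * x ->
  INR (length A) ^ h * (4 / (3 - cos (PI / INR h)) - 1) ^ h
  <= INR K * INR (h * N) / PI * sin x + INR K * (2 * PI * INR h).
Proof.
  intros Hx HS. pose proof PI_RGT_0 as Hpi.
  assert (Hh' : 1 <= INR h) by (change 1 with (INR 1); now apply le_INR).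
  assert (HN' : 1 <= INR N) by (change 1 with (INR 1); now apply le_INR).
  set (B := _ + _). set (c := cos (PI / INR h)).
  pose proof (COS_bound (PI / INR h)) as Hc. fold c in Hc.
  (* Multiplication by [t 1] maps an interval of length [N] to one of length [2 PI / h], the width
     on which the kernel bound holds. *)
  set (t := fun j => 2 * PI * INR j / INR (h * N)).
  destruct (exponential_sum A (t 1%nat)) as [r1 [p1 [Hr1 H1]]].
  destruct (exponential_sum A (t h)) as [r2 [p2 [Hr2 H2]]].
  assert (HB1 : r1 ^ h <= B).
  { eapply Rle_trans; [apply (exponential_sum_bound 1 x r1 p1 (le_n 1) Hx HS H1)|].
    apply Rplus_le_compat_l, Rmult_le_compat_l; [apply pos_INR|].
    apply Rmult_le_compat_l; [lra | exact Hh']. }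
  assert (HB2 : r2 ^ h <= B) by apply (exponential_sum_bound h x r2 p2 Hh Hx HS H2).
  set (r := Rmax r1 r2).
  assert (Hr : 0 <= r) by (unfold r; eapply Rle_trans; [exact Hr1 | apply Rmax_l]).
  assert (HB : r ^ h <= B) by (unfold r, Rmax; destruct (Rle_dec r1 r2); assumption).
  (* Translating [A] by [(N + 1) / 2] centres it, so that its image lies in [[-PI/h, PI/h]]. *)
  set (beta := - (t 1%nat * ((INR N + 1) / 2))).
  assert (Hk : INR (length A) * (1 + c) <= (3 - c) * r).
  { rewrite <- Rsum_const.
    apply Rle_trans with (Rsum (fun a => 2 * cos (INR a * t 1%nat + beta)
        + - (1 - c) * cos (INR a * t h + INR h * beta)) A).
    - apply Rsum_le. intros a Ha.
      replace (INR a * t h + INR h * beta) with (INR h * (INR a * t 1%nat + beta)).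
      + assert (HR : Rabs (INR a * t 1%nat + beta) <= PI / INR h).
        (* After rescaling, the claim is [|2 a - (N + 1)| <= N], which follows from
           [1 <= a <= N]. *)
        { replace (INR a * t 1%nat + beta)
            with (PI / INR h * ((2 * INR a - (INR N + 1)) / INR N))
            by (unfold beta, t; rewrite mult_INR; simpl; field; lra).
          assert (Hph : 0 < PI / INR h) by (apply Rdiv_lt_0_compat; lra).
          rewrite Rabs_mult, (Rabs_pos_eq (PI / INR h)) by lra.
          rewrite <- (Rmult_1_r (PI / INR h)) at 2.
          apply Rmult_le_compat_l; [lra|].
          destruct (HA a Ha) as [Ha1 Ha2]. apply le_INR in Ha1, Ha2. simpl in Ha1.
          apply Rabs_le. split; apply (Rmult_le_reg_r (INR N)); try lra;
            unfold Rdiv; rewrite Rmult_assoc, Rinv_l; lra. }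
        pose proof (kernel_lower_bound h _ Hh HR) as Hker. fold c in Hker. lra.
      + unfold beta, t. rewrite mult_INR. simpl. field. lra.
    - rewrite Rsum_lin, H1, H2.
      (* The weights [2] and [1 - c] are nonnegative, so the worst cosines are [1] and [-1], for a
         total of [2 + (1 - c) = 3 - c]. *)
      pose proof (COS_bound (p1 + beta)). pose proof (COS_bound (p2 + INR h * beta)).
      assert (r1 <= r) by apply Rmax_l. assert (r2 <= r) by apply Rmax_r.
      assert (r1 * cos (p1 + beta) <= r) by nra.
      assert (- r <= r2 * cos (p2 + INR h * beta)) by nra.
      nra. }
  rewrite <- Rpow_mult_distr. apply Rle_trans with (r ^ h); [|exact HB].
  assert (Hq : 4 / (3 - c) - 1 = (1 + c) / (3 - c)) by (field; lra).
  rewrite Hq. apply pow_incr. pose proof (pos_INR (length A)) as Hk0. split.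
  - apply Rmult_le_pos; [exact Hk0|]. apply Rmult_le_pos; [lra|].
    apply Rlt_le, Rinv_0_lt_compat. lra.
  - apply (Rmult_le_reg_r (3 - c)); [lra|].
    replace (INR (length A) * ((1 + c) / (3 - c)) * (3 - c)) with (INR (length A) * (1 + c))
      by (field; lra).
    lra.
Qed.

End Bound.

(** * From the inequality at fixed [N] to the asymptotic bound *)

Lemma le_Rpower_root (h : nat) k q lam :
  (2 <= h)%nat -> 1 < lam -> 0 < q -> 0 <= k -> k ^ h <= lam * q ->
  k <= lam * Rpower q (1 / INR h).
Proof.
  intros Hh Hlam Hq Hk H. set (y := Rpower q (1 / INR h)).
  assert (Hh' : 0 < INR h) by (apply lt_0_INR; lia).
  assert (Hy : 0 < y) by apply exp_pos.
  assert (Hyh : y ^ h = q).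
  { rewrite <- Rpower_pow by exact Hy. unfold y. rewrite Rpower_mult.
    replace (1 / INR h * INR h) with 1 by (field; lra). now apply Rpower_1. }
  (* Otherwise [k^h] would be at least [lam^h * q], which exceeds [lam * q]. *)
  destruct (Rle_lt_dec k (lam * y)) as [Hle|Hlt]; [exact Hle|].
  assert (Hp : (lam * y) ^ h <= k ^ h) by (apply pow_incr; split; nra).
  rewrite Rpow_mult_distr, Hyh in Hp.
  assert (lam ^ 1 < lam ^ h) by (apply Rlt_pow; [exact Hlam | lia]).
  nra.
Qed.

Theorem theorem1p1 (h g : nat) (Hg : (2 <= g)%nat) (Hh : (4 <= h)%nat)
  (xh : R) (Hx0 : 0 < xh) (HxPI : xh < PI)
  (Hxeq : sin xh / xh = (4 / (3 - cos (PI / INR h)) - 1) ^ h) :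
  forall eps : R, 0 < eps ->
  exists N0 : nat, forall N : nat, (N0 <= N)%nat ->
  forall A : list nat, subset_interval N A -> Bhg_set h g A ->
    INR (length A) <=
      (1 + eps) * Rpower (xh * INR (fact h) * INR h * INR g * INR N / PI) (1 / INR h).
Proof.
  intros eps Heps. pose proof PI_RGT_0 as Hpi.
  (* The factor [1 + eps] is spent under the root: [m * x'] is [1 + eps] times the base of the power
     in the conclusion. Here [x'] may exceed [PI]. *)
  set (x' := xh * (1 + eps)). assert (Hx' : xh < x') by (unfold x'; nra).
  set (d := sin xh / xh - sin x' / x').
  (* The threshold is fixed before the sign of [d] is known; [d > 0] is shown only in the case
     [x' < x <= PI]. *)
  destruct (INR_unbounded (2 * PI * PI / (x' * d))) as [n Hn].
  exists (S n). intros N HN A [HA1 HA2] HB.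
  set (K := (g * fact h)%nat).
  assert (HK := Bhg_representations h g A HA1 HB). fold K in HK.
  assert (HK0 : 0 < INR K).
  { apply lt_0_INR. pose proof (lt_O_fact h). unfold K. nia. }
  assert (HN0 : 0 < INR N) by (apply lt_0_INR; lia).
  assert (Hh0 : 0 < INR h) by (apply lt_0_INR; lia).
  assert (HM0 : 0 < INR (h * N)) by (rewrite mult_INR; nra).
  set (k := INR (length A)). assert (Hk : 0 <= k) by apply pos_INR.
  set (m := INR K * INR (h * N) / PI).
  assert (Hm : 0 < m) by (apply Rdiv_lt_0_compat; nra).
  set (x := k ^ h / m). assert (Hmx : k ^ h = m * x) by (unfold x; field; lra).
  assert (Hx : 0 <= x <= PI).
  { assert (Hle := card_pow_le h N K A ltac:(lia) ltac:(lia) HA2 HK). fold k in Hle.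
    pose proof (pow_le k h Hk) as Hkh. split.
    - apply (Rmult_le_reg_l m); lra.
    - apply (Rmult_le_reg_l m); [exact Hm|]. rewrite <- Hmx. unfold m.
      replace (INR K * INR (h * N) / PI * PI) with (INR K * INR (h * N)) by (field; lra).
      exact Hle. }
  assert (Hmain := card_pow_bound h N K A ltac:(lia) ltac:(lia) HA2 HK x Hx Hmx).
  rewrite <- Hxeq in Hmain. fold k m in Hmain. rewrite Hmx in Hmain.
  assert (Hxx : x <= x').
  { destruct (Rle_lt_dec x x') as [Hle|Hlt]; [exact Hle|]. exfalso.
    assert (Hd : 0 < d).
    { unfold d. pose proof (sin_slope_decr xh x' Hx0 Hx' ltac:(lra)) as Hs.
      apply (Rmult_lt_reg_r (xh * x')); [nra|].
      replace ((sin xh / xh - sin x' / x') * (xh * x'))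
        with (x' * sin xh - xh * sin x') by (field; lra). lra. }
    (* The slope [sin x / x] is below its value at [x'], so the main inequality loses at least
       [m * x * d]. *)
    assert (Hsx : sin x <= x * (sin x' / x')).
    { pose proof (sin_slope_decr x' x ltac:(lra) Hlt ltac:(lra)) as Hs.
      apply (Rmult_le_reg_r x'); [lra|].
      replace (x * (sin x' / x') * x') with (x * sin x') by (field; lra). lra. }
    (* The left side is linear in [N] through [m], while the right side is independent of [N]; the
       choice of [n] makes this impossible. *)
    assert (Hgap : m * (x' * d) <= INR K * (2 * PI * INR h)).
    { apply Rle_trans with (m * (x * d)).
      - apply Rmult_le_compat_l; nra.
      - unfold d. apply (Rmult_le_compat_l m) in Hsx; lra. }
    assert (HnN : 2 * PI * PI / (x' * d) < INR N).
    { eapply Rlt_trans; [exact Hn|]. apply lt_INR. lia. }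
    assert (Hxd : 0 < x' * d) by nra.
    assert (2 * PI * PI < INR N * (x' * d)).
    { apply (Rmult_lt_compat_r (x' * d)) in HnN; [|exact Hxd].
      replace (2 * PI * PI / (x' * d) * (x' * d)) with (2 * PI * PI) in HnN
        by (field; split; lra).
      exact HnN. }
    apply (Rmult_le_compat_r PI) in Hgap; [|lra].
    replace (m * (x' * d) * PI) with (INR K * INR h * (INR N * (x' * d))) in Hgap
      by (unfold m; rewrite mult_INR; field; lra).
    assert (0 < INR K * INR h) by nra. nra. }
  apply le_Rpower_root; [lia | lra | | exact Hk |].
  - pose proof (INR_fact_lt_0 h). assert (0 < INR g) by (apply lt_0_INR; lia).
    apply Rdiv_lt_0_compat; [|lra]. repeat apply Rmult_lt_0_compat; assumption.
  - rewrite Hmx. apply Rle_trans with (m * x').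
    + apply Rmult_le_compat_l; lra.
    + apply Req_le. unfold m, x', K. rewrite !mult_INR. field. lra.
Qed.
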